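(* Let $S=\langle a_1,\ldots,a_e\rangle\neq\mathbb{N}$ be a numerical semigroup with minimal generators $a_1<\cdots<a_e$, genus $g(S)$ and Frobenius element $F(S)$, and assume $a_e=2g(S)+1$. Then $$\frac{g(S)}{F(S)+1}\le\frac{e-1}{e}.$$
   Context: A numerical semigroup is a submonoid $S$ of $(\mathbb{N},+)$ (with $0\in\mathbb{N}$) whose complement in $\mathbb{N}$ is finite. It has a unique finite minimal generating set. Writing $S=\langle a_1,\ldots,a_e\rangle$ with $a_1<\cdots<a_e$ means that $a_1,\ldots,a_e$ are exactly the minimal generators of $S$. The genus $g(S)$ is the number of positive integers not in $S$. The Frobenius element $F(S)$ is the largest integer not in $S$. *)

(* Defs.v *)
From mathcomp Require Import all_boot all_order all_algebra.
From mathcomp Require Import finmap.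
From mathcomp Require Import mathcomp_extra boolp classical_sets functions.
From mathcomp Require Import cardinality.

Set Implicit Arguments.
Unset Strict Implicit.
Unset Printing Implicit Defensive.

Local Open Scope classical_set_scope.

Definition submonoid (M : set nat) : Prop :=
  M 0 /\ forall m n, M m -> M n -> M (m + n).

Record numerical_semigroup := NumericalSemigroup {
  nsg_set :> set nat;
  nsg_submonoid : submonoid nsg_set;
  nsg_cofinite : finite_set (~` nsg_set)
}.

Definition generated (A : set nat) : set nat := smallest submonoid A.

Definition minimal_generating_set (M A : set nat) : Prop :=
  generated A = M /\
  forall B : set nat, B `<=` A -> generated B = M -> B = A.

Definition genus (S : numerical_semigroup) : nat :=
  #|` fset_set ([set n : nat | 0 < n] `&` ~` S) |%fset.

Definition int_gaps (S : numerical_semigroup) : set int :=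
  ~` (Posz @` S).

(* The largest element of [int_gaps S] always exists (it is -1 when S is all
   of nat), so the default value of [xget] is never used. *)
Definition frobenius (S : numerical_semigroup) : int :=
  xget (-1)%R (int_gaps S `&` ubound (int_gaps S)).

(* Main.v *)
Require Import Defs.
From mathcomp Require Import all_boot all_order all_algebra.
From mathcomp Require Import finmap.
From mathcomp Require Import mathcomp_extra boolp classical_sets functions.
From mathcomp Require Import cardinality.
From mathcomp Require Import zify.

Set Implicit Arguments.
Unset Strict Implicit.
Unset Printing Implicit Defensive.

Import Order.POrderTheory GRing.Theory Num.Theory.

Local Open Scope classical_set_scope.
Local Open Scope ring_scope.

(** Write [x] for the largest generator and [g] for the genus, so that
[x = 2 * g + 1].  A minimal generator is never the sum of two nonzero elements
of [S], hence among [s] and [x - s], where [0 < s < x], at least one is a gap.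
These [g] pairs already use up all [g] gaps: every gap [z] lies below [x] and
is the reflection of an element, i.e. [x - z] is in [S]
([gap_reflection]).  In other words [S] without [x] is a symmetric numerical
semigroup with Frobenius number [x].

A positive element of [S] can be split as a positive generator plus an element
of [S].  Applied to [x - z] this gives [z = x - (b + s)] with [s] in [S] and [b]
one of the [e - 1] generators other than [x].  Moreover [x - b] is a gap, so
[s < x - b <= F]: there are only [n] choices for [s], where [n] counts the
elements of [S] up to the Frobenius number [F].  Therefore [g <= (e - 1) * n].
Since [n + g = F + 1], adding [(e - 1) * g] to both sides gives
[e * g <= (e - 1) * (F + 1)], which is the claim ([wilf_of_gap_bound]).

The numbers [x - b] contain the pseudo-Frobenius numbers of [S], so this is the
classical bound of [F + 1] by [(t + 1) * n], with [t] the type of [S], together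
with [t <= e - 1]. *)

(** * Generators of a submonoid *)

Lemma submonoid_generated (A : set nat) : submonoid (generated A).
Proof.
split=> [M [[M0 _] _] //|m n Am An M [Mmon AM]].
by apply: Mmon.2; [apply: Am|apply: An].
Qed.

Lemma sub_generated (A : set nat) : A `<=` generated A.
Proof. exact: sub_smallest. Qed.

Lemma generated_min (A M : set nat) :
  submonoid M -> A `<=` M -> generated A `<=` M.
Proof. by move=> Mmon; exact: smallest_sub. Qed.

(** If [y] were redundant, dropping it would leave a strictly smaller set of
generators. *)
Lemma minimal_generator_notin (M A : set nat) (y : nat) :
  minimal_generating_set M A -> A y -> ~ generated (A `\ y) y.
Proof.
move=> [genA minA] Ay geny.
have AyA : A `\ y `<=` A by move=> z [].
have genAy : generated (A `\ y) = M.
  rewrite -genA; apply/seteqP; split; apply: generated_min.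
  - exact: submonoid_generated.
  - by move=> z /AyA; exact: sub_generated.
  - exact: submonoid_generated.
  - move=> z Az; case: (eqVneq z y) => [-> //|/eqP zy].
    by apply: sub_generated; split.
by have := Ay; rewrite -(minA _ AyA genAy) => -[_]; exact.
Qed.

(** An element smaller than [y] is a combination of generators other than [y],
so two elements smaller than [y] cannot add up to the minimal generator [y]. *)
Lemma minimal_generator_irreducible (M A : set nat) (y s t : nat) :
  minimal_generating_set M A -> A y -> M s -> M t -> (0 < s)%N -> (0 < t)%N ->
  (s + t)%N <> y.
Proof.
move=> minA Ay Ms Mt s0 t0 sty; apply: (minimal_generator_notin minA Ay).
have genAy : submonoid (generated (A `\ y)) by exact: submonoid_generated.
have below z : M z -> (z < y)%N -> generated (A `\ y) z.
  rewrite -minA.1 => Mz zy.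
  suff: (y <= z)%N \/ generated (A `\ y) z by case=> //; rewrite leqNgt zy.
  (* Numbers that are at least [y] are added in order to get a submonoid which
     contains [y] as well as the other generators. *)
  apply: (@generated_min _ [set n | (y <= n)%N \/ generated (A `\ y) n]) Mz.
    split=> [|m n] /=; first by right; exact: genAy.1.
    move=> [ym|Bm] [yn|Bn]; [left; lia|left; lia|left; lia|].
    by right; exact: genAy.2.
  move=> n An /=; case: (eqVneq n y) => [->|/eqP ny]; first by left.
  by right; apply: sub_generated; split.
rewrite -[X in generated _ X]sty.
by apply: genAy.2; apply: below => //; lia.
Qed.

Lemma generated_split (A : set nat) (s : nat) :
  generated A s -> (0 < s)%N ->
  exists b t, [/\ A b, (0 < b)%N, generated A t & s = (b + t)%N].
Proof.
move=> As s0.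
have genA : submonoid (generated A) by exact: submonoid_generated.
(* The remainder of a sum [m + n] is the remainder of [m] plus [n], so membership
   in the span has to be carried along the induction. *)
pose P n := generated A n /\ ((0 < n)%N ->
  exists b t, [/\ A b, (0 < b)%N, generated A t & n = (b + t)%N]).
suff [_] : P s by exact.
apply: (@generated_min _ P) As; last first.
  move=> n An; split=> [|n0]; first exact: sub_generated.
  by exists n, 0%N; split=> //; [exact: genA.1|rewrite addn0].
split=> [|m n [Am mP] [An nP]]; first by split=> //; exact: genA.1.
split=> [|mn0]; first exact: genA.2.
have [m0|m0] := posnP m; first by move: mn0; rewrite m0; exact: nP.
have [b [t [Ab b0 At ->]]] := mP m0.
by exists b, (t + n)%N; split; rewrite ?addnA//; exact: genA.2.
Qed.

(** * Gaps and the Frobenius number *)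

Definition gaps (S : numerical_semigroup) : {fset nat} :=
  fset_set ([set n : nat | (0 < n)%N] `&` ~` S).

Lemma mem_gaps (S : numerical_semigroup) (z : nat) :
  (z \in gaps S) = ~~ `[< (S : set nat) z >].
Proof.
rewrite in_fset_set; last exact/finite_setIr/nsg_cofinite.
apply/idP/idP => [|nSz]; rewrite inE.
  by case=> _ nSz; apply/asboolPn.
split; last exact/asboolPn.
case: z nSz => // /asboolPn[]; exact: (nsg_submonoid S).1.
Qed.

Lemma frobenius_max_gap (S : numerical_semigroup) :
  (S : set nat) <> setT ->
  exists F : nat, [/\ frobenius S = F%:Z, F \in gaps S &
    forall z, z \in gaps S -> (z <= F)%N].
Proof.
move=> hS.
have [z0 nSz0] : exists z, z \in gaps S.
  apply: contrapT => /forallNP nog; apply: hS; apply/seteqP; split=> // z _.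
  by apply: contrapT => nSz; apply: (nog z); rewrite mem_gaps; apply/asboolPn.
have [F FG Fmax] : exists2 F, F \in gaps S &
    forall z, z \in gaps S -> (z <= F)%N.
  have bnd z : z \in gaps S -> (z <= \max_(i <- gaps S) i)%N.
    by move=> zG; exact: leq_bigmax_seq.
  by case: (ex_maxnP (ex_intro _ z0 nSz0) bnd) => F FG Fmax; exists F.
exists F; split=> //.
have FP : (int_gaps S `&` ubound (int_gaps S)) F%:Z.
  split=> [[s Ss [sF]]|[z|z] //= nz].
    by move: FG; rewrite mem_gaps -sF => /asboolPn.
  rewrite lez_nat; apply: Fmax; rewrite mem_gaps; apply/asboolPn => Sz.
  by apply: nz; exists z.
rewrite /frobenius; case: xgetP => [f _ [fgap fub]|/(_ F%:Z)//].
by apply/eqP; rewrite eq_le fub ?FP.2//; exact: FP.1.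
Qed.

(** * The reflection through the largest generator *)

(** Each [s] with [0 < s <= 2 * g] is a gap or has a gap as its reflection, and
there are only [g] gaps, so reflecting the elements of [S] in this range yields
each gap exactly once. *)
Lemma gap_reflection (S : numerical_semigroup) (x z : nat) :
  x = (2 * genus S + 1)%N ->
  (forall s t, (S : set nat) s -> (S : set nat) t ->
    (0 < s)%N -> (0 < t)%N -> (s + t)%N <> x) ->
  z \in gaps S -> (z < x)%N /\ (S : set nat) (x - z)%N.
Proof.
move=> xE irr zG; set g := genus S in xE.
have sizeG : size (gaps S) = g by [].
pose p n := `[< (S : set nat) n >].
pose E := [seq n <- iota 1 (2 * g) | p n].
have memE n : n \in E -> (0 < n < x)%N /\ (S : set nat) n.
  rewrite mem_filter mem_iota => /andP[/asboolP Sn nr]; split=> //; lia.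
pose refl := [seq (x - n)%N | n <- E].
have refl_uniq : uniq refl.
  rewrite map_inj_in_uniq ?filter_uniq ?iota_uniq//.
  by move=> m n /memE[mx _] /memE[nx _]; lia.
have refl_gap : {subset refl <= gaps S}.
  move=> _ /mapP[n /memE[nx Sn] ->]; rewrite mem_gaps; apply/asboolPn => Sxn.
  by apply: (irr n (x - n)%N) => //; lia.
have size_refl : (g <= size refl)%N.
  have : (size (iota 1 (2 * g)) <= size (E ++ gaps S))%N.
    apply: uniq_leq_size (iota_uniq _ _) _ => n nr.
    by rewrite mem_cat mem_filter nr andbT mem_gaps; exact: orbN.
  by rewrite size_iota size_cat sizeG size_map; lia.
have /mapP[n /memE[nx Sn] ->] : z \in refl.
  by rewrite (uniq_min_size refl_uniq refl_gap _).2 ?sizeG.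
have -> : (x - (x - n))%N = n by lia.
by split=> //; lia.
Qed.

(** * From a bound on the gaps to Wilf's inequality *)

Lemma count_gaps_elements (S : numerical_semigroup) (F : nat) :
  (forall z, z \in gaps S -> (z <= F)%N) ->
  (count (fun n => `[< (S : set nat) n >]) (iota 0 F.+1) + genus S <= F.+1)%N.
Proof.
move=> Fmax; set p := fun n => _; rewrite -[leqRHS](size_iota 0).
rewrite -(count_predC p) leq_add2l -size_filter.
apply: uniq_leq_size => [|z zG]; first exact: fset_uniq.
by rewrite mem_filter mem_iota /= -mem_gaps zG ltnS Fmax.
Qed.

Lemma wilf_of_gap_bound (g F n e : nat) :
  (0 < e)%N -> (g <= e.-1 * n)%N -> (n + g <= F.+1)%N ->
  g%:R / (F%:Z + 1)%:~R <= (e%:R - 1) / e%:R :> rat.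
Proof.
case: e => // e _ /= gn nF.
have -> : (F%:Z + 1)%:~R = F.+1%:R :> rat by rewrite intrD -natr1.
have -> : e.+1%:R - 1 = e%:R :> rat by rewrite -natr1 addrK.
rewrite ler_pdivrMr ?ltr0Sn//.
rewrite mulrAC ler_pdivlMr ?ltr0Sn//.
rewrite -!natrM ler_nat.
by have := leq_mul (leqnn e) nF; lia.
Qed.

Theorem theorem4p1 (S : numerical_semigroup) (e : nat) (a : e.-tuple nat)
    (hS : (S : set nat) <> setT)
    (ha_sorted : sorted ltn a)
    (ha_gens : minimal_generating_set S [set` a])
    (ha_last : last 0%N a = (2 * genus S + 1)%N) :
  (genus S)%:R / (frobenius S + 1)%:~R <= (e%:R - 1) / e%:R :> rat.
Proof.
have [F [-> FG Fmax]] := frobenius_max_gap hS.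
set x := (2 * genus S + 1)%N in ha_last.
have xa : x \in (a : seq nat).
  by have := mem_last 0%N a; rewrite ha_last inE => /predU1P[|//]; lia.
have e0 : (0 < e)%N by rewrite -(size_tuple a); case: (tval a) xa.
have irr s t : (S : set nat) s -> (S : set nat) t ->
    (0 < s)%N -> (0 < t)%N -> (s + t)%N <> x.
  exact: minimal_generator_irreducible ha_gens xa.
have SE : generated [set` a] = S := ha_gens.1.
pose N := [seq n <- iota 0 F.+1 | `[< (S : set nat) n >]].
apply: (@wilf_of_gap_bound _ _ (size N)) => //; last first.
  by rewrite size_filter; exact: count_gaps_elements.
suff gapE : {subset gaps S <=
    [seq (x - (b + s))%N | b <- rem x a, s <- N]}.
  have := uniq_leq_size (fset_uniq _) gapE.
  by rewrite size_allpairs size_rem// size_tuple.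
move=> z zG.
have [zx] : (z < x)%N /\ (S : set nat) (x - z)%N by exact: gap_reflection.
rewrite -SE => /generated_split[|b [s [ab b0]]]; first lia.
rewrite SE => Ss xzE.
have z0 : (0 < z)%N.
  have := zG; rewrite mem_gaps lt0n; apply: contra => /eqP ->.
  by apply/asboolP; exact: (nsg_submonoid S).1.
have Sb : (S : set nat) b by rewrite -SE; exact: sub_generated.
have xb_gap : (x - b)%N \in gaps S.
  rewrite mem_gaps; apply/asboolPn => Sxb.
  by apply: (irr b (x - b)%N) => //; lia.
apply/allpairsP; exists (b, s); split=> /=.
- (* As [b <= x - z] and [z > 0], the generator [b] is not [x]. *)
  rewrite mem_rem_uniq ?inE; last exact: sorted_uniq ltn_trans ltnn _ ha_sorted.
  by rewrite ab andbT; apply/eqP; lia.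
- (* The gap [x - b] is at most [F], and [s = (x - b) - z] lies below it. *)
  rewrite mem_filter mem_iota; apply/andP; split; first exact/asboolP.
  by have := Fmax _ xb_gap; lia.
- lia.
Qed.
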